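(* Let $a_1,a_2,b_1,b_2\in\mathbb{N}$ with $2\le b_2\le b_1$, $1\le a_k<b_k$ and $\gcd(a_k,b_k)=1$ for $k=1,2$, and $\tfrac{a_1}{b_1}\not\equiv\pm\tfrac{a_2}{b_2}\pmod 1$. Then there exists $\bm{c}\in[0,1]^2$ such that for all $n\in\mathbb{N}$ \[ n\left(\tfrac{a_1}{b_1},\tfrac{a_2}{b_2}\right)\bmod 1\notin\mathcal{S}_{1/4}(\bm{c})\bmod 1 \] if and only if \[ (b_1,b_2)\in\{(5,5),(6,3),(8,4)\}\cup\{(b_1,2):2\le b_1\in\mathbb{N}\}. \]
   Context: For $\bm{x}\in\mathbb{R}^2$, $\bm{x}\bmod 1$ is taken componentwise with values in $[0,1)$, and for a set $X\subseteq\mathbb{R}^2$, $X\bmod 1=\{\bm{x}\bmod 1:\bm{x}\in X\}$. For $\lambda>0$ and $\bm{c}\in\mathbb{R}^2$, $\mathcal{S}_\lambda(\bm{c})=\{\bm{x}\in\mathbb{R}^2:|x_1-c_1|<\lambda,\ |x_2-c_2|<\lambda\}$. $\mathbb{N}$ includes $0$. *)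

(* Defs.v *)
From HB Require Import structures.
From mathcomp Require Import all_boot all_order all_algebra.
From mathcomp Require Import classical_sets reals.

Set Implicit Arguments.
Unset Strict Implicit.
Unset Printing Implicit Defensive.

Import Order.TTheory GRing.Theory Num.Theory.

Local Open Scope classical_set_scope.
Local Open Scope ring_scope.

Definition mod1 (R : realType) (x : R * R) : R * R :=
  (x.1 - (Num.floor x.1)%:~R, x.2 - (Num.floor x.2)%:~R).

Definition open_square (R : realType) (lambda : R) (c : R * R) : set (R * R) :=
  [set x | `|x.1 - c.1| < lambda /\ `|x.2 - c.2| < lambda].

Definition eqmod1 (R : realType) (x y : R) : Prop := x - y \is a Num.int.

(* Main.v *)
(* Write d = gcd(b1, b2). After scaling the axes by b1 and b2, the orbit is the
   set of all integer points (i, j) with a2 i = a1 j mod d, and one asks whether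
   it meets every open box with sides b1 / 2 and b2 / 2. On each row and each
   column the orbit is a residue class modulo d, so if b1 >= 3 d or b2 >= 3 d
   (and b2 >= 3) a single line through the box suffices. Otherwise b1 = 2 d,
   b2 = d, where two rows suffice if d >= 5, or b1 = b2 = d, where the orbit is
   { j = u i mod d } with 2 <= |u| < d / 2 and consecutive columns are compared.
   The remaining pairs have explicit empty squares. *)

Require Import Defs.
From HB Require Import structures.
From mathcomp Require Import all_boot all_order all_algebra.
From mathcomp Require Import classical_sets reals.
From mathcomp Require Import zify ring lra.

Set Implicit Arguments.
Unset Strict Implicit.
Unset Printing Implicit Defensive.

Import Order.TTheory GRing.Theory Num.Theory.

Local Open Scope classical_set_scope.
Local Open Scope ring_scope.

(** * Passage from the torus to integer coordinates *)

Lemma mod1_image_squareP (R : realType) (lambda : R) (c p : R * R) :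
  (@mod1 R @` open_square lambda c) (mod1 p) <->
  exists k1 k2 : int,
    `|p.1 + k1%:~R - c.1| < lambda /\ `|p.2 + k2%:~R - c.2| < lambda.
Proof.
case: c p => c1 c2 [p1 p2]; split=> /=.
  case=> -[x1 x2] [/= h1 h2] [e1 e2].
  exists (Num.floor x1 - Num.floor p1), (Num.floor x2 - Num.floor p2).
  by rewrite !intrB; split; [move: h1|move: h2]; congr (`| _ | < _); lra.
case=> k1 [k2 [h1 h2]]; exists (p1 + k1%:~R, p2 + k2%:~R) => //=.
by rewrite /mod1 /= !floorDrz ?intr_int // !intrKfloor !intrD; congr pair; ring.
Qed.

Lemma scaled_dist_lt (R : realType) (n : nat) (a b : nat) (k : int) (c : R) :
  (0 < b)%N ->
  (`|n%:R * (a%:R / b%:R) + k%:~R - c| < 1 / 4) =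
  (`|(n%:Z * a%:Z + k * b%:Z)%:~R - b%:R * c| < b%:~R / 4).
Proof.
move=> b0; have bR : (0 : R) < b%:R by rewrite ltr0n.
rewrite intrD !intrM -!pmulrn.
have -> : n%:R * a%:R + k%:~R * b%:R - b%:R * c =
  b%:R * (n%:R * (a%:R / b%:R) + k%:~R - c) by field; rewrite gt_eqF.
by rewrite normrM (gtr0_norm bR) -(ltr_pM2l bR) div1r.
Qed.

Lemma int_near_bounds (R : realType) (z l h : int) (x r : R) :
  l%:~R <= x - r -> x + r <= h%:~R -> `|z%:~R - x| < r -> l < z < h.
Proof.
move=> lx xh; rewrite ltr_norml => /andP[h1 h2].
by rewrite -(ltr_int R l) -(ltr_int R z); apply/andP; split; lra.
Qed.

(** * The orbit as a congruence modulo the gcd *)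

Lemma coprimez_inv (a b : int) :
  coprimez a b -> exists u v : int, u * a + v * b = 1.
Proof.
by move=> /eqP ab; have [u [v e]] := Bezoutz a b; exists u, v; rewrite e.
Qed.

Lemma mul_neq1 (d z : int) : 2 <= d -> z * d <> 1.
Proof. by move=> d2; have [z0|z0] := leP z 0; nia. Qed.

(** Chinese remaindering: [n] must be [u1 * i] modulo [b1] and [u2 * j] modulo [b2], with [u1], [u2]
    inverse to [a1], [a2]. The congruence makes these residues agree modulo the gcd. *)
Lemma orbit_of_congruence (a1 a2 b1 b2 : nat) (i j q : int) :
  (0 < b1)%N -> (0 < b2)%N -> coprime a1 b1 -> coprime a2 b2 ->
  a2%:Z * i - a1%:Z * j = q * (gcdn b1 b2)%:Z ->
  exists (n : nat) (k1 k2 : int),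
    n%:Z * a1%:Z + k1 * b1%:Z = i /\ n%:Z * a2%:Z + k2 * b2%:Z = j.
Proof.
move=> b1_0 b2_0 co1 co2.
have [u1 [v1 e1]] : exists u v : int, u * a1%:Z + v * b1%:Z = 1.
  exact: coprimez_inv.
have [u2 [v2 e2]] : exists u v : int, u * a2%:Z + v * b2%:Z = 1.
  exact: coprimez_inv.
have [s [t]] := Bezoutz b1 b2.
have -> : gcdz b1 b2 = (gcdn b1 b2)%:Z by [].
have /dvdnP[m1 hm1] := dvdn_gcdl b1 b2; have /dvdnP[m2 hm2] := dvdn_gcdr b1 b2.
have {hm1} : b1%:Z = m1%:Z * (gcdn b1 b2)%:Z by rewrite {1}hm1 PoszM.
have {hm2} : b2%:Z = m2%:Z * (gcdn b1 b2)%:Z by rewrite {1}hm2 PoszM.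
move: (gcdn b1 b2)%:Z => d hm2 hm1 est eq.
pose q' := - q * u1 * u2 + u2 * j * v1 * m1 - u1 * i * v2 * m2.
have hq' : u2 * j - u1 * i = d * q'.
  have E1 : u2 * j * (u1 * a1%:Z + v1 * b1%:Z) = u2 * j by rewrite e1 mulr1.
  have E2 : u1 * i * (u2 * a2%:Z + v2 * b2%:Z) = u1 * i by rewrite e2 mulr1.
  rewrite -E1 -E2 hm1 hm2 /q'.
  have -> : d * (- q * u1 * u2 + u2 * j * v1 * m1 - u1 * i * v2 * m2) =
    - (q * d) * u1 * u2 + d * (u2 * j * v1 * m1 - u1 * i * v2 * m2) by ring.
  by rewrite -eq; ring.
pose n := u1 * i + s * b1%:Z * q'.
(* The added multiple of [b1 * b2] makes the index nonnegative and keeps both residues. *)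
pose N := n + `|n|%:Z * b1%:Z * b2%:Z.
have N0 : 0 <= N.
  have B0 : (0 < b1 * b2)%N by rewrite muln_gt0 b1_0.
  rewrite /N -mulrA -PoszM -lerBlDl sub0r (@le_trans _ _ `|n|%:Z) //.
    by rewrite abszE -normrN ler_norm.
  by rewrite -PoszM lez_nat leq_pmulr.
exists `|N|%N, (v1 * i - a1%:Z * s * q' - a1%:Z * `|n|%:Z * b2%:Z),
  (v2 * j + a2%:Z * t * q' - a2%:Z * `|n|%:Z * b1%:Z).
rewrite gez0_abs //; split.
  by rewrite -[RHS]mul1r -e1 /N /n; ring.
have hn : n = u2 * j - t * b2%:Z * q'.
  rewrite /n; have -> : u2 * j = u1 * i + d * q' by rewrite -hq'; ring.
  by rewrite -est; ring.
by rewrite -[RHS]mul1r -e2 /N {1}hn; ring.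
Qed.

(** * Orbit points in open boxes *)

Lemma floor_shift (R : realType) (d : int) (s z : R) : 0 < d ->
  exists k : int, z < s + k%:~R * d%:~R <= z + d%:~R.
Proof.
move=> d0; have dR : (0 : R) < d%:~R by rewrite ltr0z.
exists (Num.floor ((z - s) / d%:~R) + 1).
have := floor_le ((z - s) / d%:~R); have := floorD1_gt ((z - s) / d%:~R).
rewrite ler_pdivlMr // ltr_pdivrMr //.
rewrite !intrD => h1 h2; apply/andP; split; lra.
Qed.

Lemma int_in_class (R : realType) (d s : int) (x r : R) :
  0 < d -> d%:~R < 2 * r ->
  exists k : int, `|(s + k * d)%:~R - x| < r.
Proof.
move=> d0 dr; have [k /andP[k1 k2]] := floor_shift s%:~R (x - r) d0.
exists k; rewrite intrD intrM ltr_norml; apply/andP; split; lra.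
Qed.

(** The first side exceeds 1, so some column [i] meets the box; there the admissible [j] form a
    class modulo [d], and the second side is at least [3 * d / 2]. *)
Lemma cover_long_fibre (R : realType) (a1 a2 b1 b2 d : int) (x y : R) :
  0 < d -> coprimez a1 d ->
  3 <= b1 -> 3 * d <= b2 ->
  exists i j q : int, [/\ a2 * i - a1 * j = q * d,
    `|i%:~R - x| < b1%:~R / 4 & `|j%:~R - y| < b2%:~R / 4].
Proof.
move=> d0 /coprimez_inv[u [v e]] b1_3 b2_3.
have b1R : (3 : R) <= b1%:~R by rewrite (ler_int R 3).
have b2R : (3 : R) * d%:~R <= b2%:~R by rewrite -(intrM R 3) ler_int.
have dR : (0 : R) < d%:~R by rewrite ltr0z.
have [||i] := @int_in_class R 1 0 x (b1%:~R / 4); [by []|lra|].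
rewrite add0r mulr1 => hi.
have [||k hk] := @int_in_class R d (u * a2 * i) y (b2%:~R / 4); [by []|lra|].
exists i, (u * a2 * i + k * d), (v * a2 * i - a1 * k); split=> //.
by rewrite -[a2 * i]mul1r -e; ring.
Qed.

(* The columns meeting the square carry the values [u * i] modulo [d]; a walk
   with steps [u < d / 2] cannot jump over an open interval of length [d / 2],
   and leaves its complement after at most [d / (2 * u) + 1] steps. *)
Lemma cover_slope (R : realType) (u d : int) (x y : R) :
  2 <= u -> 2 * u < d -> 6 < d ->
  (d = 8 -> u <> 2) ->
  exists i k : int,
    `|i%:~R - x| < d%:~R / 4 /\ `|(u * i + k * d)%:~R - y| < d%:~R / 4.
Proof.
move=> u2 ud d6 d8; have u0 : 0 < u by lia.
have uR : (0 : R) < u%:~R by rewrite ltr0z.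
have udR : (2 : R) * u%:~R < d%:~R by rewrite -(intrM R 2) ltr_int.
have d6R : (6 : R) < d%:~R by rewrite (ltr_int R 6).
have [l] := @floor_shift R 1 0 (x - d%:~R / 4) isT.
rewrite add0r mulr1 => /andP[l1 l2].
(* The signs are reversed so that [v] below satisfies [y - 3 * d / 4 <= v < y + d / 4]: it is in the
   target interval or at most [d / 2] short of entering it. *)
have [k /andP[k1 k2]] := @floor_shift R d (- (u * l)%:~R) (- y - d%:~R / 4)
  (lt_trans (isT : (0 < 6 :> int)) d6).
pose v := u%:~R * l%:~R - k%:~R * d%:~R : R.
have [v_gt|v_le] := ltP (y - d%:~R / 4) v.
  exists l, (- k); rewrite !intrD !intrM in k1 k2 *.
  rewrite !ltr_norml; split; apply/andP; rewrite /v in v_gt *; split; lra.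
have [t /andP[t1 t2]] := floor_shift v (y - d%:~R / 4) u0.
have ht : 2 * u * (t - 1) <= d.
  rewrite -(ler_int R) !(intrM, intrD, intrB) /=.
  rewrite !intrM in k1 k2; rewrite /v in t1 t2; lra.
(* This puts column [l + t <= x - d / 4 + 1 + t] before [x + d / 4]. For [d = 8], [u = 2] the bound
   [ht] would allow [t = 3], giving equality. *)
have t2d : 2 * t + 2 < d by nia.
have t0 : 0 < t.
  rewrite -(ltr0z R) -(pmulr_lgt0 _ uR); lra.
have tR : (2 : R) * t%:~R + 2 < d%:~R.
  by rewrite -(intrM R 2) -(intrD R _ 2) ltr_int.
have t0R : (0 : R) < t%:~R by rewrite ltr0z.
exists (l + t), (- k); rewrite !ltr_norml !(intrM, intrD, intrN) /v in t1 t2 *.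
by split; apply/andP; split; lra.
Qed.

Lemma int_balanced_rep (w d : int) : 0 < d ->
  exists k : int, - d < 2 * (w + k * d) <= d.
Proof.
move=> d0; have := divz_eq w d; have := ltz_pmod w d0.
have := modz_ge0 w (lt0r_neq0 d0).
move: (w %/ d)%Z (w %% d)%Z => q r r0 rd e.
have [h|h] := leP (2 * r) d; [exists (- q)|exists (- q - 1)]; nia.
Qed.

(** The slope [u] is [a2 / a1] modulo [d], taken in [(- d / 2, d / 2]]. The two non-divisibilities
    exclude 1 and -1; invertibility of [u] excludes 0, [d / 2], and 2 and -2 for [d = 6, 8]. *)
Lemma cover_equal (R : realType) (a1 a2 d : int) (x y : R) :
  2 <= d -> d <> 5 ->
  coprimez a1 d -> coprimez a2 d ->
  ~ (d %| a1 - a2)%Z -> ~ (d %| a1 + a2)%Z ->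
  exists i j q : int, [/\ a2 * i - a1 * j = q * d,
    `|i%:~R - x| < d%:~R / 4 & `|j%:~R - y| < d%:~R / 4].
Proof.
move=> d2 d5 /coprimez_inv[u1 [v1 e1]] /coprimez_inv[u2 [v2 e2]] hB hD.
have [k hk] := int_balanced_rep (u1 * a2) (lt_le_trans (isT : 0 < 2 :> int) d2).
set u := u1 * a2 + k * d in hk.
pose q := a1 * k - v1 * a2.
have hu : u * a1 = a2 + q * d.
  have {1}-> : a2 = (u1 * a1 + v1 * d) * a2 by rewrite e1 mul1r.
  by rewrite /u /q; ring.
have {e2} [U [V hUV]] : exists U V : int, U * u + V * d = 1.
  exists (u2 * a1), (v2 - u2 * q); rewrite -e2.
  have -> : u2 * a1 * u = u2 * (u * a1) by ring.
  by rewrite hu; ring.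
clearbody u q; have uD : u <> 1.
  by move=> u1E; apply: hB; apply/dvdzP; exists q; move: hu; rewrite u1E; lia.
have uN : u <> -1.
  by move=> u1E; apply: hD; apply/dvdzP; exists (- q);
    move: hu; rewrite u1E; lia.
have uhalf : 2 * u <> d.
  move=> E; apply: (@mul_neq1 u (U + 2 * V)); first by lia.
  by rewrite -[RHS]hUV -E; ring.
have u0 : u <> 0.
  by move=> E; apply: (@mul_neq1 d V d2); rewrite -[RHS]hUV E; ring.
have u2_even : (d = 6 \/ d = 8) -> u <> 2 /\ u <> -2.
  by case=> E; split=> E'; move: hUV; rewrite E E'; lia.
have [up|un] := ltP 0 u.
  have [||||i [l [hi hj]]] := @cover_slope R u d x y; try lia.
  exists i, (u * i + l * d), (- q * i - a1 * l); split=> //.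
  have -> : a2 = u * a1 - q * d by rewrite hu; ring.
  ring.
(* A negative slope becomes positive after reflecting the second axis. *)
have [||||i [l [hi hj]]] := @cover_slope R (- u) d x (- y); try lia.
exists i, (u * i - l * d), (- q * i + a1 * l); split=> //.
  have -> : a2 = u * a1 - q * d by rewrite hu; ring.
  ring.
rewrite -normrN; move: hj; congr (`| _ | < _).
by rewrite !(intrM, intrD, intrN); ring.
Qed.

(* For each of two consecutive rows [j], [j + 1] the points of the row form a
   class modulo [d], which can miss the open interval of length [d] only if it
   is the class of the end points; this cannot happen in both rows. *)
Lemma cover_double (R : realType) (a1 a2 d : int) (x y : R) :
  5 <= d -> coprimez a1 d -> coprimez a2 d ->
  exists i j q : int, [/\ a2 * i - a1 * j = q * d,
    `|i%:~R - x| < (2 * d)%:~R / 4 & `|j%:~R - y| < d%:~R / 4].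
Proof.
move=> d5 /coprimez_inv[u1 [v1 e1]] /coprimez_inv[u2 [v2 e2]].
have d0 : 0 < d by lia.
have d5R : (5 : R) <= d%:~R by rewrite (ler_int R 5).
have [j] := @floor_shift R 1 0 (y - d%:~R / 4) isT.
rewrite add0r mulr1 => /andP[j1 j2].
have row (l : int) : `|l%:~R - y| < d%:~R / 4 ->
    (exists i j q : int, [/\ a2 * i - a1 * j = q * d,
      `|i%:~R - x| < (2 * d)%:~R / 4 & `|j%:~R - y| < d%:~R / 4]) \/
    exists k : int, (u2 * a1 * l + k * d)%:~R = x + d%:~R / 2.
  move=> hl.
  have [k /andP[k1 k2]] := floor_shift (u2 * a1 * l)%:~R (x - d%:~R / 2) d0.
  have [k3|k3] := ltP ((u2 * a1 * l)%:~R + k%:~R * d%:~R) (x + d%:~R / 2).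
    left; exists (u2 * a1 * l + k * d), l, (a2 * k - v2 * a1 * l); split=> //.
      by rewrite -[a1 * l in LHS]mul1r -e2; ring.
    by rewrite ltr_norml intrD (intrM _ k) (intrM _ 2); apply/andP; split; lra.
  by right; exists k; rewrite intrD (intrM _ k); lra.
have [||[k hk]] := row j; [|by []|].
  by rewrite ltr_norml; apply/andP; split; lra.
(* Since [d / 2 > 2], row [j + 1 <= y - d / 4 + 2] is still inside the box. *)
have [||[k' hk']] := row (j + 1); [|by []|].
  by rewrite ltr_norml intrD; apply/andP; split; lra.
(* Subtracting the two rows would make [d] divide [u2 * a1], a unit modulo [d]. *)
have /eqP := etrans hk (esym hk'); rewrite eqr_int => /eqP E.
have d2 : 2 <= d by lia.
case: (@mul_neq1 d (v2 + a2 * u2 * v1 + a2 * u1 * (k - k')) d2).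
have E' : u2 * a1 = (k - k') * d by lia.
rewrite -[RHS]e2 -[u2 in RHS]mulr1 -e1.
have -> : u2 * (u1 * a1 + v1 * d) = u1 * (u2 * a1) + u2 * v1 * d by ring.
by rewrite E'; ring.
Qed.

Lemma coprime_dvdz_r (a b : nat) (d : nat) :
  coprime a b -> (d %| b)%N -> coprimez a d.
Proof. by move=> ab db; exact: coprime_dvdr db ab. Qed.

Lemma cover_orbit (R : realType) (a1 a2 b1 b2 : nat) (x y : R) :
  (3 <= b2)%N -> (b2 <= b1)%N -> coprime a1 b1 -> coprime a2 b2 ->
  ~ (b1 = b2 /\ (b1%:Z %| a1%:Z - a2%:Z)%Z) ->
  ~ (b1 = b2 /\ (b1%:Z %| a1%:Z + a2%:Z)%Z) ->
  (b1, b2) <> (5, 5)%N -> (b1, b2) <> (6, 3)%N -> (b1, b2) <> (8, 4)%N ->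
  exists i j q : int, [/\ a2%:Z * i - a1%:Z * j = q * (gcdn b1 b2)%:Z,
    `|i%:~R - x| < b1%:~R / 4 & `|j%:~R - y| < b2%:~R / 4].
Proof.
move=> b2_3 b21 co1 co2 hB hD n55 n63 n84.
have d0 : (0 < gcdn b1 b2)%N by rewrite gcdn_gt0; lia.
have cod1 := coprime_dvdz_r co1 (dvdn_gcdl b1 b2).
have cod2 := coprime_dvdz_r co2 (dvdn_gcdr b1 b2).
have /dvdnP[m1 hm1] := dvdn_gcdl b1 b2; have /dvdnP[m2 hm2] := dvdn_gcdr b1 b2.
have co : coprime m1 m2.
  have := muln_gcdl m1 m2 (gcdn b1 b2); rewrite -hm1 -hm2 => /eqP.
  by rewrite -[X in _ == X]mul1n eqn_pmul2r.
move: (gcdn b1 b2) d0 cod1 cod2 hm1 hm2 => d d0 cod1 cod2 hm1 hm2.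
have [m2_3|m2_3] := leqP 3 m2.
  apply: cover_long_fibre => //; nia.
have [m1_3|m1_3] := leqP 3 m1.
  have [||||j [i [q [e hj hi]]]] :=
    @cover_long_fibre R a2%:Z a1%:Z b2%:Z b1%:Z d%:Z y x => //; try nia.
  by exists i, j, (- q); split=> //; rewrite mulNr -e; ring.
have [m1_0 m2_0] : (0 < m1)%N /\ (0 < m2)%N by nia.
(* Both cofactors are 1 or 2; coprimality excludes [(2, 2)] and [b2 <= b1] excludes [(1, 2)]. *)
have m2E : m2 = 1%N.
  move: co m1_0 m2_0 m1_3 m2_3 hm1 hm2.
  by case: m1 m2 => [|[|[|?]]] [|[|[|?]]] //; lia.
rewrite m2E mul1n in hm2; subst d.
have [m1E|m1E] : m1 = 1%N \/ m1 = 2%N by lia.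
  have {hm1} b12 : b1 = b2 by rewrite hm1 m1E mul1n.
  subst b1; apply: cover_equal => //; first by lia.
  - by move=> b5; apply: n55; congr pair; lia.
  - by move=> h; apply: hB.
  - by move=> h; apply: hD.
rewrite hm1 m1E in n63 n84 *; rewrite PoszM; apply: cover_double => //.
have : b2 <> 3 by move=> E; apply: n63; rewrite E.
have : b2 <> 4 by move=> E; apply: n84; rewrite E.
lia.
Qed.

(** * Empty squares and the equivalence *)

Lemma slope_mod5 (a1 a2 : nat) : (0 < a1 < 5)%N -> (0 < a2 < 5)%N ->
  a1 <> a2 -> (a1 + a2)%N <> 5%N ->
  (exists s : int, a2%:Z = 2 * a1%:Z + s * 5) \/
  (exists s : int, a2%:Z = - (2 * a1%:Z) + s * 5).
Proof.
move=> h1 h2 aB aD.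
(* The ratio [a2 / a1] is a unit modulo 5 other than 1 and -1, hence 2 or 3, and 3 is -2. *)
have [h|h] : ((2 * a1) %% 5 = a2 \/ (3 * a1) %% 5 = a2)%N by lia.
  by left; exists (- ((2 * a1) %/ 5)%N%:Z); lia.
by right; exists (a1%:Z - ((3 * a1) %/ 5)%N%:Z); lia.
Qed.

Theorem theorem4p1 (R : realType) (a1 a2 b1 b2 : nat)
    (hb2 : (2 <= b2)%N) (hb21 : (b2 <= b1)%N)
    (ha1 : (1 <= a1 < b1)%N) (ha2 : (1 <= a2 < b2)%N)
    (hab1 : gcdn a1 b1 = 1%N) (hab2 : gcdn a2 b2 = 1%N)
    (hpos : ~ eqmod1 (a1%:R / b1%:R : R) (a2%:R / b2%:R))
    (hneg : ~ eqmod1 (a1%:R / b1%:R : R) (- (a2%:R / b2%:R))) :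
  (exists c : R * R,
     [/\ 0 <= c.1 <= 1, 0 <= c.2 <= 1 &
      forall n : nat,
        ~ (@mod1 R @` open_square (1 / 4) c)
            (mod1 (n%:R * (a1%:R / b1%:R), n%:R * (a2%:R / b2%:R)))])
  <->
  ([set (5, 5); (6, 3); (8, 4)]%N `|`
     [set (b, 2)%N | b in [set b : nat | (2 <= b)%N]]) (b1, b2).
Proof.
have b2_0 : (0 < b2)%N by lia.
have b1_0 : (0 < b1)%N by lia.
have co1 : coprime a1 b1 by rewrite /coprime hab1.
have co2 : coprime a2 b2 by rewrite /coprime hab2.
(* The sign [s] is 1 for [hpos] and -1 for [hneg]. *)
have eqmod1_equal (s : int) : b1 = b2 -> (b1%:Z %| a1%:Z - s * a2%:Z)%Z ->
    eqmod1 (a1%:R / b1%:R : R) (s%:~R * (a2%:R / b2%:R)).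
  move=> b12 /dvdzP[q e]; rewrite /eqmod1.
  suff -> : a1%:R / b1%:R - s%:~R * (a2%:R / b2%:R) = q%:~R :> R by [].
  have bR : (b2%:R : R) != 0 by rewrite pnatr_eq0 -lt0n.
  have := congr1 (fun z : int => z%:~R : R) e.
  rewrite b12 intrB !intrM -!pmulrn => e'.
  by apply: (mulIf bR); rewrite -e'; field.
have hnB : b1 = b2 -> ~ (b1%:Z %| a1%:Z - a2%:Z)%Z.
  move=> b12 dv; apply: hpos; rewrite -[X in eqmod1 _ X]mul1r.
  by apply: (eqmod1_equal 1) => //; rewrite mul1r.
have hnD : b1 = b2 -> ~ (b1%:Z %| a1%:Z + a2%:Z)%Z.
  move=> b12 dv; apply: hneg; rewrite -[X in - X]mul1r -mulNr.
  by apply: (eqmod1_equal (-1)) => //; rewrite mulN1r opprK.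
have hitP (c : R * R) (n : nat) :
    (@mod1 R @` open_square (1 / 4) c)
      (mod1 (n%:R * (a1%:R / b1%:R), n%:R * (a2%:R / b2%:R))) <->
    exists k1 k2 : int,
      `|(n%:Z * a1%:Z + k1 * b1%:Z)%:~R - b1%:R * c.1| < b1%:~R / 4 /\
      `|(n%:Z * a2%:Z + k2 * b2%:Z)%:~R - b2%:R * c.2| < b2%:~R / 4.
  split=> [/mod1_image_squareP[k1 [k2 /= [h1 h2]]]|[k1 [k2 [h1 h2]]]].
    by exists k1, k2; rewrite -!scaled_dist_lt.
  by apply/mod1_image_squareP; exists k1, k2; rewrite /= !scaled_dist_lt.
split.
  case=> c [_ _ avoid].
  have [|b2_3] := leqP b2 2.
    by move=> ?; right; exists b1 => /=; [lia|congr pair; lia].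
  have [->|/eqP n55] := eqVneq (b1, b2) (5, 5)%N; first by do 3!left.
  have [->|/eqP n63] := eqVneq (b1, b2) (6, 3)%N; first by left; left; right.
  have [->|/eqP n84] := eqVneq (b1, b2) (8, 4)%N; first by left; right.
  exfalso.
  have [||i [j [q [e hi hj]]]] := @cover_orbit R a1 a2 b1 b2 (b1%:R * c.1)
    (b2%:R * c.2) b2_3 hb21 co1 co2 _ _ n55 n63 n84.
  - by case=> /hnB.
  - by case=> /hnD.
  have [n [k1 [k2 [ei ej]]]] := orbit_of_congruence b1_0 b2_0 co1 co2 e.
  by apply: (avoid n); apply/hitP; exists k1, k2; rewrite ei ej.
have c01 (t : R) : 0 <= t -> t <= 1 -> 0 <= t <= 1 by move=> -> ->.
have double_avoid : b1 = (2 * b2)%N -> (b2 <= 4)%N -> exists c : R * R,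
    [/\ 0 <= c.1 <= 1, 0 <= c.2 <= 1 & forall n : nat,
      ~ (@mod1 R @` open_square (1 / 4) c)
          (mod1 (n%:R * (a1%:R / b1%:R), n%:R * (a2%:R / b2%:R)))].
  (* The scaled box is [0 < i < b2], [|j| < b2 / 4 <= 1], so only row 0 is met. There [b2] divides
     [n], hence also [i]. *)
  move=> b12 b2_4; exists (1 / 4, 0); split=> /=; try (apply: c01; lra).
  move=> n /hitP[k1 [k2 /= []]].
  have b2R : (b2%:R : R) <= 4 by rewrite (ler_nat R b2 4).
  have b2R0 : (0 : R) < b2%:R by rewrite ltr0n.
  have b1R : (b1%:R : R) = 2 * b2%:R by rewrite b12 natrM.
  rewrite -!pmulrn b1R.
  move=> /(@int_near_bounds _ _ 0 b2%:Z) => /(_ _ _)/andP[||i1 i2].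
  - lra.
  - rewrite -pmulrn; lra.
  move=> /(@int_near_bounds _ _ (-1) 1) => /(_ _ _)/andP[||j1 j2]; [lra|lra|].
  have j0 : n%:Z * a2%:Z + k2 * b2%:Z = 0 by lia.
  have : (b2%:Z %| n%:Z * a2%:Z)%Z by apply/dvdzP; exists (- k2); lia.
  rewrite Gauss_dvdzl; last first.
    by rewrite /coprimez gcdzC; exact/eqP/(congr1 Posz hab2).
  case/dvdzP=> m nE; move: i1 i2; rewrite nE b12 PoszM.
  have -> : m * b2%:Z * a1%:Z + k1 * (2%:Z * b2%:Z) =
    (m * a1%:Z + 2 * k1) * b2%:Z by ring.
  by rewrite pmulr_lgt0 // => h1; rewrite -[X in _ < X]mul1r ltr_pM2r //; lia.
case=> [[[[b1E b2E]|[b1E b2E]]|[b1E b2E]]|[b /= _ [_ b2E]]].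
- subst b1 b2; have aD : (a1 + a2)%N <> 5.
    by move=> E; apply: hnD => //; rewrite -PoszD E.
  have aB : a1 <> a2 by move=> E; apply: hnB => //; rewrite E subrr.
  have [[s hs]|[s hs]] : (exists s : int, a2%:Z = 2 * a1%:Z + s * 5) \/
      (exists s : int, a2%:Z = - (2 * a1%:Z) + s * 5).
    exact: slope_mod5.
  (* The box leaves [i] in {0, 1} and [j] in {3, 4}, while [2 * i] is 0 or 2 modulo 5. *)
  + exists (1 / 10, 7 / 10); split=> /=; try (apply: c01; lra).
    move=> n /hitP[k1 [k2 /= []]].
    set i := n%:Z * a1%:Z + _; set j := n%:Z * a2%:Z + _.
    move=> /(@int_near_bounds _ _ (-1) 2) => /(_ _ _)/andP[||i1 i2]; [lra|lra|].
    move=> /(@int_near_bounds _ _ 2 5) => /(_ _ _)/andP[||j1 j2]; [lra|lra|].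
    have : j = 2 * i + (n%:Z * s + k2 - 2 * k1) * 5.
      by rewrite /j hs /i; ring.
    by clearbody i j; lia.
  (* Here [j] is 1 or 2, while [- (2 * i)] is 0 or 3 modulo 5. *)
  + exists (1 / 10, 3 / 10); split=> /=; try (apply: c01; lra).
    move=> n /hitP[k1 [k2 /= []]].
    set i := n%:Z * a1%:Z + _; set j := n%:Z * a2%:Z + _.
    move=> /(@int_near_bounds _ _ (-1) 2) => /(_ _ _)/andP[||i1 i2]; [lra|lra|].
    move=> /(@int_near_bounds _ _ 0 3) => /(_ _ _)/andP[||j1 j2]; [lra|lra|].
    have : j = - (2 * i) + (n%:Z * s + k2 + 2 * k1) * 5.
      by rewrite /j hs /i; ring.
    by clearbody i j; lia.
- apply: double_avoid; lia.
- apply: double_avoid; lia.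
(* The second scaled side is the open interval from 0 to 1, free of integers. *)
- subst b2; exists (0, 1 / 4); split=> /=; try (apply: c01; lra).
  move=> n /hitP[k1 [k2 /= [_]]].
  move=> /(@int_near_bounds _ _ 0 1) => /(_ _ _)/andP[||j1 j2]; [lra|lra|].
  lia.
Qed.
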